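(* Let $\mathcal{U}$ be a non-trivial uniform structure on a non-empty set $X$, and let $0_{\mathcal{U}}=\bigcap\mathcal{U}$. (a) There exist a partially ordered set $\mathcal{I}$ with a zero $0_{\mathcal{I}}$ and a map $\mathbf{d}:X\times X\to\mathcal{I}_\infty$ such that $\mathcal{B}_{\mathbf{d}}=\{\mathbf{D}_\alpha:\alpha\in\mathcal{I}\setminus\{0_{\mathcal{I}}\}\}$ is a base for $\mathcal{U}$ if and only if $\mathcal{U}$ admits a base $\mathcal{B}$ such that $\mathcal{B}\cup\{0_{\mathcal{U}}\}$ is closed under arbitrary (non-empty) intersections. In this case, one can choose $\mathcal{I}$ to be the meet-complete D-index set $$\mathcal{J}^{\mathcal{B}}:=\{(A\cap A^{-1})\cup\Delta_X:A\in\mathcal{B}\}\cup\{0_{\mathcal{U}}\}$$ (ordered by inclusion) and $\mathbf{d}$ to be a pseudo uniform $\mathcal{I}$-metric. (b) If $\mathcal{U}$ admits a base $\mathcal{B}$ with $\mathcal{B}\cup\{0_{\mathcal{U}}\}$ closed under arbitrary (non-empty) intersections and the topology induced by $\mathcal{U}$ is Hausdorff, then one can find a uniform $\mathcal{J}^{\mathcal{B}}$-metric $\mathbf{d}$ on $X$ with $\mathcal{U}=\mathcal{U}_{\mathbf{d}}$.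
   Context: $\mathcal{P}_0(X\times X)$ is the collection of non-empty subsets of $X\times X$; $\Delta_X=\{(x,x):x\in X\}$; for $A,B\subseteq X\times X$, $A^{-1}=\{(y,x):(x,y)\in A\}$ and $A\circ B=\{(x,z):\exists y\in X,\ (x,y)\in A,\ (y,z)\in B\}$. A uniform structure on $X$ is a (non-empty) collection $\mathcal{U}\subseteq\mathcal{P}_0(X\times X)$ such that for all $U,V\in\mathcal{U}$ and $S\in\mathcal{P}_0(X\times X)$ with $U\subseteq S$ one has $\Delta_X\subseteq U$, $U\cap V,\,U^{-1},\,S\in\mathcal{U}$, and there is $W\in\mathcal{U}$ with $W\circ W\subseteq U$. A subcollection $\mathcal{B}\subseteq\mathcal{U}$ is a base for $\mathcal{U}$ if every $U\in\mathcal{U}$ contains some $V\in\mathcal{B}$. $\mathcal{U}$ is trivial if there is $U_0\in\mathcal{U}$ with $\mathcal{U}=\{U\subseteq X\times X:U_0\subseteq U\}$, and non-trivial otherwise (equivalently, $\bigcap\mathcal{U}\notin\mathcal{U}$). The zero of a partially ordered set $\mathcal{I}$ is its smallest element $0_{\mathcal{I}}$; $\mathcal{I}_\infty$ is $\mathcal{I}$ with a new element $\infty$ adjoined that is strictly larger than all elements of $\mathcal{I}$. $\mathcal{I}$ is meet-complete if every non-empty subset has a greatest lower bound in $\mathcal{I}$. A D-index set is a partially ordered set $\mathcal{I}$ with a zero such that $\mathcal{I}\setminus\{0_{\mathcal{I}}\}$ is non-empty and downward directed (any two elements have a common lower bound in it). For a map $\mathbf{d}:X\times X\to\mathcal{I}_\infty$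 and $\alpha\in\mathcal{I}$, $\mathbf{D}_\alpha=\{(x,y)\in X\times X:\mathbf{d}(x,y)\le\alpha\}$. For a D-index set $\mathcal{I}$, $\mathbf{d}$ is a pseudo uniform $\mathcal{I}$-metric if $\mathbf{d}(x,x)=0_{\mathcal{I}}$ and $\mathbf{d}(x,y)=\mathbf{d}(y,x)$ for all $x,y$, and there is $\Psi:\mathcal{I}\setminus\{0_{\mathcal{I}}\}\to\mathcal{I}\setminus\{0_{\mathcal{I}}\}$ with $\mathbf{D}_{\Psi(\beta)}\circ\mathbf{D}_{\Psi(\beta)}\subseteq\mathbf{D}_\beta$ for all $\beta\in\mathcal{I}\setminus\{0_{\mathcal{I}}\}$. It is a uniform $\mathcal{I}$-metric if moreover $\bigcap_{\alpha\in\mathcal{I}\setminus\{0_{\mathcal{I}}\}}\mathbf{D}_\alpha=\Delta_X$. For a pseudo uniform $\mathcal{I}$-metric $\mathbf{d}$, $\mathcal{U}_{\mathbf{d}}$ is the uniform structure having $\{\mathbf{D}_\alpha:\alpha\in\mathcal{I}\setminus\{0_{\mathcal{I}}\}\}$ as a base. *)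

(* Defs.v *)
From HB Require Import structures.
From mathcomp Require Import all_boot all_order.
From mathcomp Require Import all_classical topology.

Set Implicit Arguments.
Unset Strict Implicit.
Unset Printing Implicit Defensive.

Import Order.TTheory.
Local Open Scope classical_set_scope.

(* [None] is the adjoined element infinity. *)
Definition adjoin_infty (I : Type) : Type := option I.

Section AdjoinInftyOrder.
Context {disp : Order.disp_t} {I : porderType disp}.

HB.instance Definition _ := Choice.copy (adjoin_infty I) (option I).

Definition adjoin_infty_le (u v : adjoin_infty I) : bool :=
  match u, v with
  | _, None => true
  | None, Some _ => false
  | Some a, Some b => (a <= b)%O
  end.

Lemma adjoin_infty_le_refl : reflexive adjoin_infty_le.
Proof. by case=> [a|] //=. Qed.

Lemma adjoin_infty_le_anti : antisymmetric adjoin_infty_le.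
Proof. by case=> [a|] [b|] //= ab; rewrite (le_anti ab). Qed.

Lemma adjoin_infty_le_trans : transitive adjoin_infty_le.
Proof. by case=> [b|] [a|] [c|] //=; exact: le_trans. Qed.

HB.instance Definition _ := Order.Le_isPOrder.Build disp (adjoin_infty I)
  adjoin_infty_le_refl adjoin_infty_le_anti adjoin_infty_le_trans.

End AdjoinInftyOrder.

(* The zero z is passed explicitly (rather than through [bPOrderType]), because
   whether a given element of [JB B] below is the smallest one depends on [B]. *)
Section IndexSets.
Context {disp : Order.disp_t} {I : porderType disp}.

Definition is_zero (z : I) : Prop := forall a : I, (z <= a)%O.

Definition nonzero (z : I) : set I := [set a | a != z].

Definition D_index (z : I) : Prop :=
  [/\ is_zero z, nonzero z !=set0
    & forall a b, nonzero z a -> nonzero z b ->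
        exists c, [/\ nonzero z c, (c <= a)%O & (c <= b)%O]].

End IndexSets.

Definition meet_complete {disp : Order.disp_t} (I : porderType disp) : Prop :=
  forall S : set I, S !=set0 -> infimums S !=set0.

Section IndexedMetrics.
Context {X : Type} {disp : Order.disp_t} {I : porderType disp}.
Implicit Types (z : I) (d : X * X -> adjoin_infty I).

Definition Dball d (a : I) : set (X * X) :=
  [set p | (d p <= (Some a : adjoin_infty I))%O].

Definition Dballs z d : set_system (X * X) := [set Dball d a | a in nonzero z].

Definition pseudo_uniform_metric z d : Prop :=
  [/\ D_index z,
      forall x, d (x, x) = Some z,
      forall x y, d (x, y) = d (y, x)
    & exists2 Psi : I -> I, set_fun (nonzero z) (nonzero z) Psi
        & forall b, nonzero z b ->
            (Dball d (Psi b) \; Dball d (Psi b) `<=` Dball d b)%relation].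

Definition uniform_metric z d : Prop :=
  pseudo_uniform_metric z d
  /\ \bigcap_(a in nonzero z) Dball d a = diagonal.

Definition metric_uniformity z d : set_system (X * X) :=
  filter_from (nonzero z) (Dball d).

Lemma metric_uniformityP z d : pseudo_uniform_metric z d ->
  [/\ Filter (metric_uniformity z d),
      forall A, metric_uniformity z d A -> diagonal `<=` A,
      forall A, metric_uniformity z d A -> metric_uniformity z d (A^-1)%relation
    & forall A, metric_uniformity z d A ->
        exists2 B, metric_uniformity z d B & (B \; B `<=` A)%relation].
Proof.
case=> -[z0 [a0 a0z] zdir] dxx dC [Psi Psi0 Psisub]; split.
- apply: filter_from_filter; first by exists a0.
  move=> a b az bz; have [c [cz ca cb]] := zdir a b az bz.
  exists c => // p dpc; split; apply: le_trans dpc _;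
    by rewrite /Order.le /=.
- move=> A [a az aA] [x y] /diagonalP <-; apply: aA.
  by rewrite /Dball /= dxx; exact: z0.
- move=> A [a az aA]; exists a => // -[x y] dxy; apply: aA => /=.
  by rewrite /Dball /= dC.
- move=> A [a az aA]; exists (Dball d (Psi a)).
    by exists (Psi a); [exact: Psi0|].
  by apply: subset_trans aA; exact: Psisub.
Qed.

End IndexedMetrics.

Section UniformStructures.
Context {X : uniformType}.
Implicit Type B : set_system (X * X).

Definition trivial_uniformity : Prop :=
  exists2 U0 : set (X * X), entourage U0 & entourage = [set U | U0 `<=` U].

Definition uniform_base B : Prop :=
  B `<=` entourage /\ forall U, entourage U -> exists2 V, B V & V `<=` U.

Definition zeroU : set (X * X) := \bigcap_(U in entourage) U.

Definition bigcap_closed (C : set_system (X * X)) : Prop :=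
  forall S, S `<=` C -> S !=set0 -> C (\bigcap_(A in S) A).

Definition Jsets B : set_system (X * X) :=
  [set (A `&` A^-1)%relation `|` diagonal | A in B] `|` [set zeroU].

Definition JB B : Type := Jsets B.

HB.instance Definition _ B := SubChoice.copy (JB B) (Jsets B).
HB.instance Definition _ B :=
  [SubChoice_isSubPOrder of JB B by <: with set_display].

Definition JB_zero B : JB B := SigSub (mem_set (or_intror erefl : Jsets B zeroU)).

Lemma JB_leP B (R S : JB B) : (R <= S)%O = (val R `<=` val S) :> Prop.
Proof. exact: subsetEset. Qed.

End UniformStructures.

Arguments trivial_uniformity X : clear implicits.

(* Main.v *)
Require Import Defs.
From HB Require Import structures.
From mathcomp Require Import all_boot all_order.
From mathcomp Require Import all_classical topology.
Local Open Scope classical_set_scope.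

(** The balls of a map [d] into [I] with infinity adjoined determine [d]:
    [d p] is the least [a] with [p] in the ball of radius [a].  Hence, when a
    family of subsets of [X * X] is closed under non-empty intersections, it
    is the family of balls of a map with values in the family itself, namely
    [d p := \bigcap {R | R p}], or infinity if no [R] contains [p]; then the
    ball of radius [R] is [R] ([exists_metric_ballE]).

    If [B] is a base such that [B] with [zeroU] added is closed under
    intersections, then so is the family [Jsets B] of the symmetrized members
    of [B], because symmetrizing commutes with intersections
    ([Jsets_bigcap_closed]).  The map above, for this family, is symmetric
    because its balls are, and it vanishes on the diagonal because every ball
    contains [zeroU].  By non-triviality [zeroU] is not an entourage, so the
    balls of non-zero radius are exactly the members of [Jsets B] that are
    entourages ([nonzero_entourageP]).  They form a base, so the splitting of
    entourages provides [Psi].  In a Hausdorff space [zeroU] is the diagonal,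
    and the intersection of any base is [zeroU].

    Conversely, let the balls of non-zero radius of some [d] form a base.
    Neither [I] nor the family of balls need have intersections, so the base
    to take is that of all entourages that are intersections of balls.  What
    makes it work is a dichotomy ([bigcap_ball_dichotomy]) for the
    intersection of the balls with radii in a non-empty set [S] of non-zero
    elements.  If [S] has a non-zero lower bound, the intersection contains
    the corresponding ball and so is an entourage.  Otherwise a pair [p] in
    the intersection has a value [d p] that is a lower bound of [S], so [d p]
    is zero, and the intersection is [zeroU]. *)

(** * The intersection of all entourages *)

Section ZeroU.
Context {X : uniformType}.
Implicit Types (U : set (X * X)) (B : set_system (X * X)).

Lemma zeroU_sub U : entourage U -> zeroU `<=` U.
Proof. by move=> entU p; apply. Qed.

Lemma zeroU_refl (x : X) : zeroU (x, x).
Proof. by move=> U entU; exact: entourage_refl. Qed.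

Lemma zeroU_sym (x y : X) : zeroU (x, y) -> zeroU (y, x).
Proof. by move=> xy U entU; exact: (xy _ (entourage_inv entU)). Qed.

Lemma zeroU_not_entourage :
  ~ trivial_uniformity X -> ~ entourage (zeroU : set (X * X)).
Proof.
move=> ntX ent0; apply: ntX; exists zeroU => //.
by apply/seteqP; split=> U /=; [exact: zeroU_sub | move/filterS; exact].
Qed.

Lemma bigcap_base B : uniform_base B -> \bigcap_(A in B) A = zeroU.
Proof.
move=> [Bent Bbase]; apply/seteqP; split=> [p Bp U /Bbase [V BV]|p p0 A BA].
  by apply; exact: Bp.
exact: p0 (Bent _ BA).
Qed.

Lemma hausdorff_zeroU : hausdorff_space X -> zeroU = diagonal :> set (X * X).
Proof.
move=> hX; apply/seteqP; split=> -[x y]; last first.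
  by move=> /diagonalP <-; exact: zeroU_refl.
move=> xy0; apply/diagonalP; apply: hX => P Q.
rewrite -nbhs_entourageE => -[E entE EP].
rewrite nbhs_entourageE => /nbhs_singleton Qy.
exists y; split=> //; apply: EP; apply/xsectionP; exact: xy0.
Qed.

End ZeroU.

(** * Bases of balls *)

Lemma adjoin_infty_eq (disp : Order.disp_t) (I : porderType disp)
    (u v : adjoin_infty I) :
  (forall a, (u <= (Some a : adjoin_infty I))%O
             <-> (v <= (Some a : adjoin_infty I))%O) -> u = v.
Proof.
case: u v => [a|] [b|] // uv.
- congr Some; apply: Order.POrderTheory.le_anti; apply/andP; split.
    exact: (uv b).2 (Order.POrderTheory.lexx b).
  exact: (uv a).1 (Order.POrderTheory.lexx a).
- by have := (uv a).1 (Order.POrderTheory.lexx a).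
- by have := (uv b).2 (Order.POrderTheory.lexx b).
Qed.

Section BallBase.
Context {X : uniformType} {disp : Order.disp_t} {I : porderType disp}.
Variables (z : I) (d : X * X -> adjoin_infty I).
Hypotheses (z0 : is_zero z) (dbase : uniform_base (Dballs z d)).

Lemma metric_uniformity_base : entourage = metric_uniformity z d.
Proof.
case: dbase => Dent Dbase; apply/seteqP; split=> U.
  by move=> /Dbase [_ [a az <-] aU]; exists a.
by move=> [a az aU]; apply: (filterS aU); apply: Dent; exists a.
Qed.

Lemma Dball_mono (a b : I) : (a <= b)%O -> Dball d a `<=` Dball d b.
Proof.
by move=> ab p; rewrite /Dball /=; move/Order.POrderTheory.le_trans; apply.
Qed.

(** If [S] has a non-zero lower bound [b], the ball of radius [b] lies in the
    intersection.  If not, the pairs in the intersection are at distance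
    zero, and so lie in every ball. *)
Lemma bigcap_ball_dichotomy (S : set I) : S `<=` nonzero z -> S !=set0 ->
  entourage (\bigcap_(a in S) Dball d a) \/ \bigcap_(a in S) Dball d a = zeroU.
Proof.
case: dbase => Dent _ Sz [s Ss].
have [[b [bz bS]]|nolb] := pselect (exists b, nonzero z b /\ lbound S b).
  left; apply: (@filterS _ _ _ (Dball d b)); last by apply: Dent; exists b.
  by move=> p pb a Sa; exact: Dball_mono (bS _ Sa) _ pb.
right; apply/seteqP; split=> p; last first.
  by move=> p0 a /Sz az; apply: p0; apply: Dent; exists a.
move=> pS; rewrite -(bigcap_base _ dbase) => _ [a az <-].
have [c dpc] : exists c, d p = Some c.
  (* [S] is non-empty, so [d p] is not infinity. *)
  by have := pS _ Ss; rewrite /Dball /=; case: (d p) => // c _; exists c.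
have cS : lbound S c by move=> e /pS; rewrite /Dball /= dpc.
have cz : c = z.
  by apply: contrapT => /eqP cz; apply: nolb; exists c.
by rewrite /Dball /= dpc cz; exact: z0.
Qed.

Lemma ball_base_bigcap_closed : exists B : set_system (X * X),
  uniform_base B /\ bigcap_closed (B `|` [set zeroU]).
Proof.
pose capballs (S : set I) := \bigcap_(a in S) Dball d a.
exists [set V | entourage V
  /\ exists S, [/\ S `<=` nonzero z, S !=set0 & V = capballs S]].
split; first split.
- by move=> V [].
- move=> U /dbase.2 [_ [a az <-] aU]; exists (Dball d a) => //; split.
    by apply: dbase.1; exists a.
  by exists [set a]; split; [move=> _ -> | exists a | rewrite /capballs bigcap_set1].
- move=> T TB [A0 TA0].
  have [T0|T0] := pselect (T zeroU).
    right; apply/seteqP; split=> [p|p p0 A /TB [[entA _]|->//]]; first exact.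
    exact: p0.
  (* [S] is the union, over [A] in [T], of the largest set of radii
     representing [A]; taking the largest one avoids a choice. *)
  pose S := [set a | nonzero z a /\ exists2 A, T A & A `<=` Dball d a].
  have capT A : T A -> exists SA,
      [/\ SA `<=` nonzero z, SA !=set0 & A = capballs SA].
    by move=> TA; case: (TB _ TA) => [[]//|A0E]; case: T0; rewrite -A0E.
  have TS : \bigcap_(A in T) A = capballs S.
    apply/seteqP; split=> [p pT a [_ [A TA]]|p pS A TA]; first by apply; exact: pT.
    have [SA [SAz _ AE]] := capT _ TA; rewrite AE => a SAa; apply: pS; split.
      exact: SAz.
    by exists A => //; rewrite AE => q; exact.
  have Sz : S `<=` nonzero z by move=> a [].
  have S0 : S !=set0.
    have [SA [SAz [a SAa] AE]] := capT _ TA0; exists a; split; first exact: SAz.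
    by exists A0 => //; rewrite AE => q; exact.
  rewrite TS /capballs; have [entS|->] := bigcap_ball_dichotomy S Sz S0; last by right.
  by left; split=> //; exists S.
Qed.

End BallBase.

(** * The index set of symmetrized basic entourages *)

Section CanonicalMetric.
Context {X : uniformType}.
Variable B : set_system (X * X).
Hypothesis Bbase : uniform_base B.

Lemma JsetsW (A : set (X * X)) : B A ->
  Jsets B ((A `&` A^-1)%relation `|` diagonal).
Proof. by move=> BA; left; exists A. Qed.

Lemma JsetsP (R : set (X * X)) : Jsets B R ->
  R = zeroU \/ exists2 A, B A & forall x y, R (x, y) <-> A (x, y) /\ A (y, x).
Proof.
move=> [[A BA <-]|->]; [right; exists A => // x y; split | by left].
  by case=> [[]|/diagonalP <-] //; split; apply: entourage_refl; exact: Bbase.1.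
by move=> [xy yx]; left.
Qed.

Lemma Jsets_sym (R : set (X * X)) (x y : X) : Jsets B R -> R (x, y) -> R (y, x).
Proof. by move=> /JsetsP [->|[A _ RE]]; [exact: zeroU_sym | rewrite !RE => -[]]. Qed.

Lemma zeroU_sub_Jsets (R : set (X * X)) : Jsets B R -> zeroU `<=` R.
Proof.
move=> /JsetsP [->//|[A /Bbase.1 entA RE]] [x y] xy0; apply/RE.
by split; [exact: xy0 | exact: zeroU_sym xy0 _ entA].
Qed.

(** The diagonal already lies in every entourage, so adjoining it to a
    symmetrized basic entourage does not spoil the inclusion in [U]. *)
Lemma Jsets_base (U : set (X * X)) : entourage U ->
  exists R, [/\ Jsets B R, entourage R & R `<=` U].
Proof.
move=> entU; have [V BV VU] := Bbase.2 _ entU.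
have entV := Bbase.1 _ BV.
exists ((V `&` V^-1)%relation `|` diagonal); split; first exact: JsetsW.
  by apply: filterS (entourage_invI entV) => p; left.
by move=> [x y] [[/VU]|/diagonalP <-] //; exact: entourage_refl.
Qed.

Hypothesis Bcap : bigcap_closed (B `|` [set zeroU]).

(** Symmetrizing commutes with intersections.  The intersection of the
    members of [B] involved may be [zeroU], which is already symmetric. *)
Lemma Jsets_bigcap_closed : bigcap_closed (Jsets B).
Proof.
move=> S SJ [R0 SR0].
have [S0|S0] := pselect (S zeroU).
  right; apply/seteqP; split=> [p|p p0 A /SJ JA]; first exact.
  exact: zeroU_sub_Jsets p0.
have preS R : S R ->
    exists2 A, B A & forall x y, R (x, y) <-> A (x, y) /\ A (y, x).
  by move=> SR; case: (JsetsP _ (SJ _ SR)) => // R0E; case: S0; rewrite -R0E.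
pose T := [set A | B A /\ exists2 R, S R
                     & forall x y, R (x, y) <-> A (x, y) /\ A (y, x)].
have STE x y : (\bigcap_(R in S) R) (x, y) <->
    (\bigcap_(A in T) A) (x, y) /\ (\bigcap_(A in T) A) (y, x).
  split=> [xyS|[xyT yxT] R SR].
    by split=> A [_ [R SR RE]]; case/RE: (xyS _ SR).
  have [A BA RE] := preS _ SR.
  by apply/RE; split; [apply: xyT | apply: yxT]; split=> //; exists R.
have [||BT|T0] := @Bcap T.
- by move=> A [BA _]; left.
- by have [A BA RE] := preS _ SR0; exists A; split=> //; exists R0.
- left; exists (\bigcap_(A in T) A) => //; apply/seteqP; split=> -[x y].
    case=> [[xyT yxT]|/diagonalP <-]; first exact/STE.
    by move=> R /SJ JR; exact: zeroU_sub_Jsets JR _ (zeroU_refl x).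
  by move=> /STE xyT; left.
- right; apply/seteqP; split=> -[x y]; first by move=> /STE; rewrite T0 => -[].
  by move=> xy0; apply/STE; rewrite T0; split=> //; exact: zeroU_sym.
Qed.

Lemma JB_inf (S : set (JB B)) : S !=set0 ->
  exists R : JB B, val R = \bigcap_(Q in S) val Q.
Proof.
move=> [R0 SR0].
have JS : Jsets B (\bigcap_(Q in S) val Q).
  rewrite -(bigcap_image S val id); apply: Jsets_bigcap_closed.
    by move=> _ [R _ <-]; exact: set_mem (valP R).
  by exists (val R0); exists R0.
by exists (SigSub (mem_set JS)).
Qed.

Lemma JB_meet_complete : meet_complete (JB B).
Proof.
move=> S S0; have [R RE] := JB_inf S S0; exists R; split.
  by move=> Q SQ; rewrite JB_leP RE => p; exact.
by move=> Q QS; rewrite JB_leP RE => p Qp P /QS; rewrite JB_leP; exact.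
Qed.

(** The members of the index set that contain [p] have an intersection in the
    index set, and it still contains [p]: it is the least of them, and serves
    as [d p].  If there are none, [d p] is infinity. *)
Lemma exists_metric_ballE : exists d : X * X -> adjoin_infty (JB B),
  forall R : JB B, Dball d R = val R.
Proof.
have /choice [d dE] : forall p : X * X, exists u : adjoin_infty (JB B),
    forall R : JB B, (u <= (Some R : adjoin_infty (JB B)))%O <-> val R p.
  move=> p; pose S := [set R : JB B | val R p].
  have [S0|S0] := pselect (S !=set0); last first.
    by exists None => R; split=> // Rp; case: S0; exists R.
  have [M ME] := JB_inf S S0; exists (Some M) => R.
  split=> [MR|Rp].
    have {}MR : (M <= R)%O by [].
    by move: MR; rewrite JB_leP; apply; rewrite ME.
  suff : (M <= R)%O by [].
  by rewrite JB_leP ME => q; exact.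
by exists d => R; apply/seteqP; split=> p /dE.
Qed.

Hypothesis ntX : ~ trivial_uniformity X.

(** This is where non-triviality enters: were [zeroU] an entourage, it could
    be the only basic one, and no radius but zero would be left. *)
Lemma nonzero_entourageP (R : JB B) :
  nonzero (JB_zero B) R <-> entourage (val R).
Proof.
split=> [/eqP R0|entR].
  case: (JsetsP _ (set_mem (valP R))) => [RE|[A /Bbase.1 entA RE]].
    by case: R0; apply: val_inj.
  by apply: filterS (entourage_invI entA) => -[x y] [Axy Ayx]; exact/RE.
by apply/eqP => R0; apply: (zeroU_not_entourage ntX); rewrite R0 in entR.
Qed.

Lemma JB_base (U : set (X * X)) : entourage U ->
  exists2 R : JB B, nonzero (JB_zero B) R & val R `<=` U.
Proof.
move=> /Jsets_base [R [JR entR RU]].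
by exists (SigSub (mem_set JR)) => //; exact/nonzero_entourageP.
Qed.

Lemma JB_zeroP : is_zero (JB_zero B).
Proof. by move=> R; rewrite JB_leP; exact: zeroU_sub_Jsets (set_mem (valP R)). Qed.

Lemma JB_D_index : D_index (JB_zero B).
Proof.
split; first exact: JB_zeroP.
- by have [R R0 _] := JB_base _ entourageT; exists R.
- move=> P Q /nonzero_entourageP entP /nonzero_entourageP entQ.
  have [R R0 RPQ] := JB_base _ (filterI entP entQ).
  by exists R; split=> //; rewrite JB_leP => p /RPQ [].
Qed.

Section BallsAreIndices.
Variable d : X * X -> adjoin_infty (JB B).
Hypothesis dE : forall R : JB B, Dball d R = val R.

Lemma metric_leP p (R : JB B) :
  (d p <= (Some R : adjoin_infty (JB B)))%O <-> val R p.
Proof. by rewrite -dE. Qed.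

Lemma metric_uniform_base : uniform_base (Dballs (JB_zero B) d).
Proof.
split=> [_ [R /nonzero_entourageP entR <-]|U /JB_base [R R0 RU]].
  by rewrite dE.
by exists (val R) => //; exists R.
Qed.

Lemma metric_pseudo_uniform : pseudo_uniform_metric (JB_zero B) d.
Proof.
split; first exact: JB_D_index.
- move=> x; apply: adjoin_infty_eq => R; split=> _; first exact: JB_zeroP.
  by apply/metric_leP; exact: zeroU_sub_Jsets (set_mem (valP R)) _ (zeroU_refl x).
- move=> x y; apply: adjoin_infty_eq => R; rewrite !metric_leP.
  by split; exact: Jsets_sym (set_mem (valP R)).
- have /choice [Psi PsiP] : forall R : JB B, exists Q : JB B,
      nonzero (JB_zero B) R ->
      nonzero (JB_zero B) Q /\ (val Q \; val Q `<=` val R)%relation.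
    move=> R; have [R0|R0] := pselect (nonzero (JB_zero B) R); last by exists R.
    have [W entW WR] := entourage_split_ex ((nonzero_entourageP R).1 R0).
    have [Q Q0 QW] := JB_base _ entW; exists Q => _; split=> //.
    by move=> p [q pq qp]; apply: WR; exists q; exact: QW.
  exists Psi => R R0; first exact: (PsiP R R0).1.
  by rewrite !dE; exact: (PsiP R R0).2.
Qed.

Lemma metric_uniform : hausdorff_space X -> uniform_metric (JB_zero B) d.
Proof.
move=> hX; split; first exact: metric_pseudo_uniform.
by rewrite -(hausdorff_zeroU hX) -(bigcap_base _ metric_uniform_base) bigcap_image.
Qed.

End BallsAreIndices.
End CanonicalMetric.

Theorem theorem17 (X : uniformType) :
  [set: X] !=set0 -> ~ trivial_uniformity X ->
  [/\ (exists (disp : Order.disp_t) (I : porderType disp) (z : I)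
              (d : X * X -> adjoin_infty I),
         is_zero z /\ uniform_base (Dballs z d))
      <->
      (exists B : set_system (X * X),
         uniform_base B /\ bigcap_closed (B `|` [set zeroU])),

      forall B : set_system (X * X),
        uniform_base B -> bigcap_closed (B `|` [set zeroU]) ->
        [/\ meet_complete (JB B), D_index (JB_zero B)
          & exists d : X * X -> adjoin_infty (JB B),
              pseudo_uniform_metric (JB_zero B) d
              /\ uniform_base (Dballs (JB_zero B) d)]
    & forall B : set_system (X * X),
        uniform_base B -> bigcap_closed (B `|` [set zeroU]) ->
        hausdorff_space X ->
        exists d : X * X -> adjoin_infty (JB B),
          uniform_metric (JB_zero B) d
          /\ entourage = metric_uniformity (JB_zero B) d].
Proof.
move=> _ ntX; split.
- split=> [[disp [I [z [d [z0 dbase]]]]]|[B [Bbase Bcap]]].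
    exact: ball_base_bigcap_closed dbase.
  have [d dE] := exists_metric_ballE B Bbase Bcap.
  exists set_display, (JB B), (JB_zero B), d.
  by split; [exact: JB_zeroP | exact: metric_uniform_base].
- move=> B Bbase Bcap; split; first exact: JB_meet_complete.
    exact: JB_D_index.
  have [d dE] := exists_metric_ballE B Bbase Bcap.
  by exists d; split; [exact: metric_pseudo_uniform | exact: metric_uniform_base].
- move=> B Bbase Bcap hX; have [d dE] := exists_metric_ballE B Bbase Bcap.
  exists d; split; first exact: metric_uniform.
  by apply: metric_uniformity_base; exact: metric_uniform_base.
Qed.
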